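(* For all integers $n \ge 6$ we have $h_4(n) = 4$.
   Context: For a positive integer $n$, $h_4(n)$ denotes the smallest integer $h$ such that for all sets $A \subseteq \{1, 2, \ldots, 2n\}$ with $\lvert A \rvert \ge n + h$, there exist four distinct positive integers $b_1, b_2, b_3, b_4$ with $b_i + b_j \in A$ for all $1 \le i < j \le 4$. The $b_i$ themselves do not have to be elements of $A$. *)

(* Defs.v *)
From mathcomp Require Import all_boot all_order all_algebra.
From mathcomp Require Import finmap.

Set Implicit Arguments.
Unset Strict Implicit.
Unset Printing Implicit Defensive.

Definition has_four_sums (A : {fset nat}) : Prop :=
  exists b : 'I_4 -> nat,
    [/\ injective b,
        forall i, 0 < b i
      & forall i j : 'I_4, i < j -> b i + b j \in A].

Definition forces_four_sums (n : nat) (h : int) : Prop :=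
  forall A : {fset nat},
    (forall a, a \in A -> 1 <= a <= 2 * n) ->
    (n%:Z + h <= #|` A|%:Z)%R ->
    has_four_sums A.

(* [is_h4 n h] states h_4(n) = h.  The minimum ranges over all integers, so it
   determines h uniquely. *)
Definition is_h4 (n : nat) (h : int) : Prop :=
  forces_four_sums n h /\
  (forall h' : int, forces_four_sums n h' -> (h <= h')%R).

(* Main.v *)
Require Import Defs.
From mathcomp Require Import all_boot all_order all_algebra.
From mathcomp Require Import finmap.
From mathcomp Require Import zify.
From Stdlib Require Import Classical_Prop.

Set Implicit Arguments.
Unset Strict Implicit.
Unset Printing Implicit Defensive.

(** Call [cnt a 2j - j] the excess of the prefix [1, 2j] of a set [a], and say
    that [a] contains six sums if it contains the pairwise sums of four distinct
    positive integers.  For [n >= 6], a subset of [1, 2n] of excess 4 contains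
    six sums, and excess 3 does not suffice.

    Lower bound.  The odd numbers together with 2, 2n-2 and 2n have excess 3.
    Two of the four integers with the same parity have an even sum, other than
    2, hence 2n-2 or 2n; three of one parity would give three such sums, and
    with two of each parity the largest odd sum would exceed 2n
    ([extremal_free]).

    Upper bound.  Adding [d] to the four integers adds [2d] to every sum, so
    sets may be translated by even amounts ([four_sums_shift]).  In a
    counterexample with [n] minimal, the part of the set beyond [2j] is a
    smaller instance, so has excess at most 3, and therefore every nonempty
    even prefix has excess at least 1: the set is [ample].  The short suffixes,
    where minimality says nothing, are handled by small searches
    ([window_bound]).

    Ampleness makes the counterexample very rigid, because odd numbers alone
    already give prefixes of excess 0 and a generic even number creates the six
    sums.  An exhaustive search over the prefixes of length at most 40 that are
    ample and contain no six sums visits a few thousand sets per level and shows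
    that the excess is at most 3 from length 12 on, and that at length 40 only
    two shapes survive:
    - [tail_shape]: exactly 2 and all odd numbers, but for the last 8 places;
    - [head_shape]: no even number beyond 16, some even number in [4, 16], and
      excess at most 2 at 16.
    Both shapes persist as the prefix grows.  In the first, the last
    24 places behave in the same way wherever they are, and a search settles
    them ([tail_step]).  In the second, ampleness leaves at most one odd number
    beyond 16 out, and an old even number [2u] and a new one [2n] are the sums
    of [u - 1, u + 1] and of [n - d, n + d], whose cross sums are four odd
    numbers that can be chosen present ([head_step]).  In both shapes the excess
    is at most 3, so there is no counterexample ([cnt_bound]). *)

(** * Configurations of four integers *)
Definition pair_sums (b1 b2 b3 b4 : nat) : seq nat :=
  [:: b1 + b2; b1 + b3; b1 + b4; b2 + b3; b2 + b4; b3 + b4].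

Definition four_sums (a : pred nat) : Prop :=
  exists b1 b2 b3 b4,
    [/\ 0 < b1, b1 < b2, b2 < b3, b3 < b4 & all a (pair_sums b1 b2 b3 b4)].

Lemma four_sums_sub (a a' : pred nat) :
  subpred a a' -> four_sums a -> four_sums a'.
Proof.
move=> sub [b1 [b2 [b3 [b4 [h1 h2 h3 h4 h]]]]].
by exists b1, b2, b3, b4; split=> //; apply: sub_all h.
Qed.

Lemma four_sums_shift d (a : pred nat) :
  four_sums (fun x => a (x + d.*2)) -> four_sums a.
Proof.
have e b b' : b + d + (b' + d) = b + b' + d.*2 by lia.
move=> [b1 [b2 [b3 [b4 [h1 h2 h3 h4 h]]]]].
exists (b1 + d), (b2 + d), (b3 + d), (b4 + d); split; try lia.
by rewrite /= !e.
Qed.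

(** * Prefixes of a set *)

(** The bits come in decreasing order of position, so that the search extends a
    prefix by consing and matches sums near the end of the prefix first. *)
Fixpoint trace (a : pred nat) (v : nat) : seq bool :=
  if v is v'.+1 then a v :: trace a v' else [::].

Lemma size_trace a v : size (trace a v) = v.
Proof. by elim: v => //= v ->. Qed.

Lemma nth_trace a v i : nth false (trace a v) i = (i < v) && a (v - i).
Proof.
by elim: v i => [|v IHv] [|i] //=.
Qed.

Lemma drop_trace a v i : drop i (trace a v) = trace a (v - i).
Proof. by elim: v i => [|v IHv] [|i] //=; rewrite IHv. Qed.

Lemma trace_eqP a a' v :
  trace a v = trace a' v <-> (forall x, 0 < x <= v -> a x = a' x).
Proof.
elim: v => [|v [IH1 IH2]]; first by split=> // _ x; lia.
split=> [[e1 /IH1 e2] x hx | h] /=.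
  case: (ltngtP x v.+1) => [lt_xv | | -> //]; last by lia.
  by apply: e2; lia.
by rewrite h ?leqnn // IH2 // => x hx; apply: h; lia.
Qed.

Definition cnt (a : pred nat) (v : nat) : nat := count id (trace a v).

Lemma cntS a v : cnt a v.+1 = a v.+1 + cnt a v.
Proof. by []. Qed.

Lemma cnt_leD a u v : cnt a (u + v) <= cnt a u + v.
Proof. by elim: v => [|v IHv]; rewrite ?addn0 // addnS cntS; lia. Qed.

Lemma cnt_shift d a v :
  cnt (fun x => a (x + d)) v + cnt a d = cnt a (v + d).
Proof. by elim: v => //= v IHv; rewrite addSn !cntS -IHv -addSn addnA. Qed.

Lemma cnt_iota a v : cnt a v = count a (iota 1 v).
Proof.
elim: v => // v IHv.
by rewrite cntS -[in RHS](addn1 v) iotaD count_cat /= -IHv add1n addn0 addnC.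
Qed.

Lemma cnt_card n (A : {fset nat}) :
  (forall x, x \in A -> 1 <= x <= 2 * n) ->
  #|` A| = cnt (fun x => x \in A) n.*2.
Proof.
move=> sA; rewrite cnt_iota -size_filter; apply: perm_size.
apply: uniq_perm => [||x]; rewrite ?fset_uniq ?filter_uniq ?iota_uniq //.
rewrite mem_filter mem_iota.
by case: (boolP (x \in A)) => [/sA|//]; lia.
Qed.

(** * Exhaustive search over prefixes *)

(** Fails at the first sum missing from [r], so most tests stop early. *)
Fixpoint submask (m r : seq bool) : bool :=
  match m, r with
  | [::], _ => true
  | true :: m', b :: r' => if b then submask m' r' else false
  | false :: m', _ :: r' => submask m' r'
  | _ :: _, [::] => false
  end.

Lemma submaskP m r i : submask m r -> nth false m i -> nth false r i.
Proof.
elim: m r i => [|[] m IHm] [|[] r] [|i] //=; try exact: IHm.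
all: by rewrite nth_nil.
Qed.

(** The bits are aligned with those of a prefix of length [v], and stop at the
    smallest of the six sums. *)
Definition sums_mask (v b1 b2 b3 b4 : nat) : seq bool :=
  [seq v - i \in pair_sums b1 b2 b3 b4 | i <- iota 0 (v - (b1 + b2)).+1].

(** The configurations whose largest sum is [v]: exactly those that can appear
    when [v] is added to a prefix free of six sums. *)
Definition table (v : nat) : seq (seq bool) :=
  [seq sums_mask v b.1 b.2 b3 (v - b3)
     | b3 <- iota 1 (v.-1)./2,
       b <- [seq (b1, b2) | b2 <- iota 1 b3.-1, b1 <- iota 1 b2.-1]].

Definition hit (t : seq (seq bool)) (r : seq bool) : bool :=
  has (fun m => submask m r) t.

Lemma hit_four_sums a v : hit (table v) (trace a v) -> four_sums a.
Proof.
case/hasP=> m /allpairsPdep[b3 [b [h3 /allpairsPdep[b2 [b1 [h2 h1 eb]]] ->]]].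
rewrite {}eb; cbn [fst snd]; move: h1 h2 h3; rewrite !mem_iota => h1 h2 h3 sub.
exists b1, b2, b3, (v - b3); split; try lia.
apply/allP=> t ht.
have tv : b1 + b2 <= t <= v.
  by move: ht; rewrite !inE; do 5![case/orP=> [/eqP->|]; first lia]; move/eqP->; lia.
have := submaskP (i := v - t) sub.
rewrite (nth_map 0) ?size_iota ?nth_iota; try lia.
rewrite add0n subKn; last by lia.
by rewrite nth_trace subKn; [move=> /(_ ht) /andP[] | lia].
Qed.

Definition tables (k m : nat) : seq (seq (seq bool) * seq (seq bool)) :=
  [seq (table j.*2.+1, table j.*2.+2) | j <- iota k m].

(** Conjunction over the two bits in a form that evaluates [f false] only after
    [f true] succeeded, under eager evaluation too. *)
Definition both (f : bool -> bool) : bool := if f true then f false else false.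
Arguments both : simpl never.

Lemma bothP f : both f -> forall b, f b.
Proof. by rewrite /both; case E: (f true) => // ? []. Qed.

(** Extends the prefix [r] two places at a time, once for each entry of [ts].
    The slack [s] is what the count of the prefix has above a line of slope [p]
    per two places; a branch is dropped when the slack would become negative or
    when six sums appear.  [Q] is tested at every prefix that is reached. *)
Fixpoint explore (Q : nat -> seq bool -> bool) (p : nat)
    (ts : seq (seq (seq bool) * seq (seq bool))) (s : nat) (r : seq bool)
    : bool :=
  if Q s r then
    if ts is (t1, t2) :: ts' then
      both (fun b1 =>
        if b1 && hit t1 (b1 :: r) then true else
        both (fun b2 =>
          if b1 + b2 + s < p then true else
          if b2 && hit t2 [:: b2, b1 & r] then true else
          explore Q p ts' (b1 + b2 + s - p) [:: b2, b1 & r]))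
    else true
  else false.

(** The bound on the counts is only assumed up to the prefix where the
    conclusion is drawn, so one search covers sets of every smaller length. *)
Lemma exploreP Q p a k m s :
  ~ four_sums a ->
  explore Q p (tables k m) s (trace a k.*2) ->
  forall j, k <= j <= k + m ->
  (forall i, k <= i <= j -> p * (i - k) + cnt a k.*2 <= s + cnt a i.*2) ->
  Q (s + cnt a j.*2 - (p * (j - k) + cnt a k.*2)) (trace a j.*2).
Proof.
move=> noK; elim: m k s => [|m IHm] k s /=; case: ifP => // Qk.
  move=> _ j hj _; have -> : j = k by lia.
  by rewrite subnn muln0 add0n addnK.
move=> ex j hj low.
case: (ltngtP k j) hj low => [lt_kj hj low | | <- _ _]; [|lia|]; last first.
  by rewrite subnn muln0 add0n addnK.
have {}ex := bothP ex (a k.*2.+1); move: ex; case: ifP => [/andP[_ ht] | _].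
  by case: noK; apply: (@hit_four_sums a k.*2.+1).
move=> ex; have {ex} := bothP ex (a k.*2.+2).
have cS : cnt a k.+1.*2 = a k.*2.+2 + (a k.*2.+1 + cnt a k.*2) by [].
have := low k.+1; rewrite cS => lowS.
case: ifP => [|lep]; first by lia.
case: ifP => [/andP[_ ht] | _].
  by case: noK; apply: (@hit_four_sums a k.*2.+2).
move=> ex; have := IHm k.+1 _ ex j; rewrite cS.
have -> : p * (j - k) = p * (j - k.+1) + p by rewrite -mulnSr; congr (_ * _); lia.
set q := p * (j - k.+1).
have -> : a k.*2.+1 + a k.*2.+2 + s - p + cnt a j.*2
    - (q + (a k.*2.+2 + (a k.*2.+1 + cnt a k.*2))) =
  s + cnt a j.*2 - (q + p + cnt a k.*2) by lia.
apply; first by lia.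
move=> i hi; have := low i.
have -> : p * (i - k) = p * (i - k.+1) + p by rewrite -mulnSr; congr (_ * _); lia.
by lia.
Qed.

(** * The searches that are needed *)
Definition member (r : seq bool) (x : nat) : bool := nth false r (size r - x).

Lemma member_trace a v x : 0 < x <= v -> member (trace a v) x = a x.
Proof.
move=> hx; rewrite /member size_trace nth_trace subKn; last by lia.
by have -> : v - x < v by lia.
Qed.

Definition odd2 (x : nat) : bool := odd x || (x == 2).

Definition head_type (n : nat) (r : seq bool) : bool :=
  [&& has (member r) [:: 4; 6; 8; 10; 12; 14; 16],
      all (fun j => ~~ member r j.*2) (iota 9 (n - 8))
    & count id (drop (n.*2 - 16) r) <= 10].

Definition tail_type (n : nat) (r : seq bool) : bool :=
  drop 8 r == trace odd2 (n.*2 - 8).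

(** With slope 1 and a start from [1; 2], the slack is the excess minus 1, so
    [s <= 2] bounds the excess by 3.  The bound fails at length 10, where
    1, 2, 3, 4, 6, 7, 8, 9, 10 has excess 4 and no six sums. *)
Definition head_ok (s : nat) (r : seq bool) : bool :=
  (size r < 12) ||
  (s <= 2) && ((size r < 40) || head_type 20 r || tail_type 20 r).

Lemma head_search : explore head_ok 1 (tables 1 19) 0 [:: true; true].
Proof. by vm_compute. Qed.

(** The last 24 places of a prefix in which all but the last 10 of them are
    known to hold exactly the odd numbers: the next two places follow the same
    pattern. *)
Definition tail_ok (s : nat) (r : seq bool) : bool :=
  (size r < 24) || (s <= 2) && (drop 8 r == trace odd 16).

Lemma tail_search : explore tail_ok 1 (tables 7 5) 0 (trace odd 14).
Proof. by vm_compute. Qed.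

Lemma six_search : explore (fun _ r => size r < 12) 2 (tables 0 6) 2 [::].
Proof. by vm_compute. Qed.

Lemma ten_search :
  explore (fun _ r => size r < 14) 2 (tables 2 5) 1 (nseq 4 false).
Proof. by vm_compute. Qed.

Lemma eight_search :
  explore (fun _ r => size r < 12) 2 (tables 2 4) 0 (nseq 4 false).
Proof. by vm_compute. Qed.

(** * Small cases *)

(** Two missing elements in [1, 12] allow a prefix of length [2i] to fall short
    of full by two at most, whence slope 2 and initial slack 2. *)
Lemma cnt_six a : ~ four_sums a -> cnt a 12 <= 9.
Proof.
move=> noK; rewrite leqNgt; apply/negP=> big.
suff: size (trace a 12) < 12 by rewrite size_trace.
apply: (exploreP (j := 6) noK six_search isT) => i hi.
have := cnt_leD a i.*2 (12 - i.*2); rewrite subnKC; last by lia.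
by have -> : cnt a 0.*2 = 0 by []; lia.
Qed.

(** From place 5 on, a set of 8 consecutive numbers, or of 9 out of 10, contains
    six sums.  The offset [j >= 2] matters: without it
    1, 2, 3, 4, 6, 7, 8, 9, 10 is a counterexample. *)
Lemma window_bound a j m :
  2 <= j -> m \in [:: 4; 5] -> ~ four_sums a ->
  cnt a (j + m).*2 <= cnt a j.*2 + m + 3.
Proof.
move=> hj hm noK; rewrite leqNgt; apply/negP=> big.
(* Translate the window to start at 5 and erase what lies before it. *)
pose d := j - 2; pose a' x := (4 < x) && a (x + d.*2).
have noK' : ~ four_sums a'.
  move=> /(@four_sums_sub _ (fun x => a (x + d.*2))) h.
  by apply/noK/(@four_sums_shift d)/h => x /andP[].
have c0 : cnt a' 4 = 0 by [].
have cS k : cnt a' (4 + k) + cnt a j.*2 = cnt a (j.*2 + k).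
  elim: k => [|k IHk]; first by rewrite !addn0.
  rewrite !addnS !cntS -IHk -addnA; congr (_ + _); rewrite /a'.
  have -> : 4 < (4 + k).+1 by lia.
  by congr (nat_of_bool (a _)); rewrite /d; lia.
have low i : i <= m -> cnt a' (4 + m.*2) <= cnt a' (2 + i).*2 + 2 * (m - i).
  move=> him; have -> : 4 + m.*2 = (2 + i).*2 + 2 * (m - i) by lia.
  exact: cnt_leD.
have tot := cS m.*2; rewrite -doubleD in tot.
move: hm; rewrite !inE => /orP[] /eqP em; subst m.
- suff: size (trace a' 12) < 12 by rewrite size_trace.
  apply: (exploreP (j := 6) noK' eight_search isT) => i hi.
  have := low (i - 2); rewrite subnKC; last by lia.
  by rewrite [cnt a' 2.*2]c0; lia.
- suff: size (trace a' 14) < 14 by rewrite size_trace.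
  apply: (exploreP (j := 7) noK' ten_search isT) => i hi.
  have := low (i - 2); rewrite subnKC; last by lia.
  by rewrite [cnt a' 2.*2]c0; lia.
Qed.

(** * Sets whose even prefixes have positive excess *)

Definition ample (a : pred nat) (n : nat) : Prop :=
  forall j, 1 <= j <= n -> j < cnt a j.*2.

Lemma ample_head a : ample a 1 -> trace a 2 = [:: true; true].
Proof. by move/(_ 1 isT); rewrite /cnt /=; case: (a 2); case: (a 1). Qed.

Lemma head_classified a n :
  1 <= n <= 20 -> ample a n -> ~ four_sums a ->
  head_ok (cnt a n.*2 - n.+1) (trace a n.*2).
Proof.
move=> hn am noK.
have e2 : trace a 2 = [:: true; true].
  by apply: ample_head => j hj; apply: am; lia.
have c2 : cnt a 2 = 2 by rewrite /cnt e2.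
have := head_search; rewrite -e2 => ex.
have := exploreP (j := n) noK ex; rewrite c2.
have -> : 0 + cnt a n.*2 - (1 * (n - 1) + 2) = cnt a n.*2 - n.+1 by lia.
apply; first by lia.
by move=> i hi; have := am i; lia.
Qed.

Lemma cnt_trace a a' v : trace a v = trace a' v -> cnt a v = cnt a' v.
Proof. by rewrite /cnt => ->. Qed.

Lemma cnt_odd2 k : cnt odd2 k.+1.*2 = k.+2.
Proof.
elim: k => // k IHk; rewrite doubleS cntS cntS IHk /odd2 /= odd_double /=.
by lia.
Qed.

(** The last 24 places are translated to [1, 24]; they start beyond 2, so
    their known part consists of the odd numbers alone. *)
Lemma tail_step a n :
  13 <= n -> ample a n -> ~ four_sums a ->
  trace a (n.*2 - 10) = trace odd2 (n.*2 - 10) ->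
  trace a (n.*2 - 8) = trace odd2 (n.*2 - 8) /\ cnt a n.*2 <= n + 3.
Proof.
move=> hn am noK /trace_eqP low.
have [d ed d_gt0] : exists2 d, 12 + d = n & 0 < d by exists (n - 12); lia.
pose a' x := a (x + d.*2).
have noK' : ~ four_sums a' by move/four_sums_shift.
have odd2_shift x : 0 < x -> odd2 (x + d.*2) = odd x.
  rewrite /odd2 oddD odd_double addbF => x_gt0.
  by case: eqP; [lia | rewrite orbF].
have base : trace a' 14 = trace odd 14.
  by apply/trace_eqP => x hx; rewrite /a' low ?odd2_shift; lia.
have cd : cnt a d.*2 = d.+1.
  have -> : cnt a d.*2 = cnt odd2 d.*2.
    by apply/cnt_trace/trace_eqP => x hx; apply: low; lia.
  by rewrite -(prednK d_gt0) cnt_odd2.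
have c14 : cnt a' 14 = 7 by rewrite /cnt base.
have c' i : cnt a' i.*2 + d.+1 = cnt a (i + d).*2.
  by rewrite -cd cnt_shift doubleD.
have := tail_search; rewrite -base => ex.
have := exploreP (j := 12) noK' ex isT; rewrite [cnt a' 7.*2]c14.
case/(_ _)/orP => [i hi | | ].
- by have := c' i; have := am (i + d); lia.
- by rewrite size_trace.
case/andP=> s2 /eqP; rewrite drop_trace => /trace_eqP up.
have c12 := c' 12.
split; last by rewrite -ed; lia.
apply/trace_eqP => x hx; case: (leqP x (n.*2 - 10)) => [le|gt].
  by apply: low; lia.
have := up (x - d.*2); rewrite /a' -odd2_shift; last by lia.
by rewrite subnK; [apply; lia | lia].
Qed.

Definition head_shape (a : pred nat) (n : nat) : Prop :=
  [/\ exists2 u, 2 <= u <= 8 & a u.*2,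
      forall j, 8 < j <= n -> ~~ a j.*2
    & cnt a 16 <= 10].

(** Among 17, ..., 2n only the [n - 8] odd numbers outside [s] can be present. *)
Lemma cnt_missing (a : pred nat) n (s : seq nat) :
  8 <= n -> (forall j, 8 < j <= n -> ~~ a j.*2) -> uniq s ->
  all (fun o => [&& 16 < o <= n.*2, odd o & ~~ a o]) s ->
  cnt a n.*2 + size s + 8 <= cnt a 16 + n.
Proof.
move=> hn noev us /allP hs.
have {1}-> : n.*2 = 16 + (n.*2 - 16) by lia.
rewrite !cnt_iota iotaD count_cat -(size_filter _ (iota (1 + 16) _)).
set F := filter a (iota (1 + 16) _); set G := filter odd (iota 17 (n.*2 - 16)).
have sizeG : size G = n - 8.
  rewrite /G size_filter; have -> : n.*2 - 16 = (n - 8).*2 by lia.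
  elim: (n - 8) => // k IHk.
  rewrite doubleS -(addn2 k.*2) iotaD count_cat IHk /= oddD odd_double; lia.
suff : size (F ++ s) <= size G by rewrite size_cat sizeG; lia.
apply: uniq_leq_size => [|x].
  rewrite cat_uniq us filter_uniq ?iota_uniq // andbT /=.
  apply/hasPn=> x /hs /and3P[_ _ /negbTE nax].
  by rewrite mem_filter nax.
rewrite mem_cat !mem_filter !mem_iota => /orP[|/hs]; last by lia.
case: (boolP (odd x)) => [_|ev /andP[ax hx]]; first by lia.
have := noev x./2; have -> : x./2.*2 = x by lia.
by rewrite ax => h; have := h _; lia.
Qed.

(** Otherwise [u - 1], [u + 1], [n - d], [n + d] have their six sums in [a]. *)
Lemma cross_sums (a : pred nat) n u d :
  1 < u -> 0 < d -> u + d + 1 < n -> a u.*2 -> a n.*2 -> ~ four_sums a ->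
  [|| ~~ a (n + u - d - 1), ~~ a (n + u - d + 1),
      ~~ a (n + u + d - 1) | ~~ a (n + u + d + 1)].
Proof.
move=> hu hd hn au an noK; rewrite -!negb_and; apply/negP=> /and4P[h1 h2 h3 h4].
apply: noK; exists (u - 1), (u + 1), (n - d), (n + d); split; [lia..|].
rewrite /pair_sums.
have -> : u - 1 + (u + 1) = u.*2 by lia.
have -> : n - d + (n + d) = n.*2 by lia.
have -> : u - 1 + (n - d) = n + u - d - 1 by lia.
have -> : u + 1 + (n - d) = n + u - d + 1 by lia.
have -> : u - 1 + (n + d) = n + u + d - 1 by lia.
have -> : u + 1 + (n + d) = n + u + d + 1 by lia.
by rewrite /= au an h1 h2 h3 h4.
Qed.

(** By ampleness and the excess at 16, at most one odd number in [17, 2n] is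
    missing.  If [2n + 2] were present, the cross sums for the distances [d] and
    [d + 4], with [d] in [1, 2] of the parity that makes them odd, would give two
    disjoint sets of odd numbers, each containing a missing one. *)
Lemma head_step a n :
  20 <= n -> ample a n.+1 -> ~ four_sums a ->
  head_shape a n -> head_shape a n.+1.
Proof.
move=> hn am noK [[u hu au] noev c16]; split=> //; first by exists u.
move=> j hj; case: (ltngtP j n.+1) hj => [lt_jn hj|gt|-> _]; [|lia|].
  by apply: noev; lia.
apply/negP=> an.
have two o o' : 16 < o -> o < o' -> o' <= n.*2 -> odd o -> odd o' ->
    ~~ a o -> ~~ a o' -> False.
  move=> lo lo' ho' od od' ao ao'.
  have := @cnt_missing a n [:: o; o'] _ noev _ _; rewrite /= inE od od' ao ao'.
  have := am n; lia.
have [d hd od] : exists2 d, 1 <= d <= 2 & odd (n.+1 + u + d) = false.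
  by case E: (odd (n.+1 + u)); [exists 1 | exists 2]; rewrite // addnC oddD E.
have := @cross_sums a n.+1 u d _ _ _ au an noK.
have := @cross_sums a n.+1 u (d + 4) _ _ _ au an noK.
case/(_ _ _ _)/or4P => [|||h1|h1|h1|h1]; try lia.
all: case/(_ _ _ _)/or4P => [|||h2|h2|h2|h2]; try lia.
all: first [by apply: (two _ _ _ _ _ _ _ h1 h2); lia
           | by apply: (two _ _ _ _ _ _ _ h2 h1); lia].
Qed.

(** * The upper bound *)

(** The count does not follow from the pattern, which leaves 8 places free. *)
Definition tail_shape (a : pred nat) (n : nat) : Prop :=
  trace a (n.*2 - 8) = trace odd2 (n.*2 - 8) /\ cnt a n.*2 <= n + 3.

Lemma head_or_tail a n :
  20 <= n -> ample a n -> ~ four_sums a -> head_shape a n \/ tail_shape a n.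
Proof.
elim: n => // n IHn hn am noK.
case: (leqP 20 n) => [{}hn|lt_n].
  have am' : ample a n by move=> j hj; apply: am; lia.
  case: (IHn hn am' noK) => [/(head_step hn am noK)|[low _]]; [by left|right].
  by apply: tail_step => //; lia.
have en : n.+1 = 20 by lia.
rewrite en in am *.
have /orP[|/andP[s2]] := head_classified (n := 20) isT am noK.
  by rewrite size_trace.
rewrite size_trace => /orP[/orP[//|/and3P[]] | /eqP].
- move=> ev noev; rewrite drop_trace => c16; left; split=> //.
    case/hasP: ev => y hy; rewrite member_trace; last first.
      by move: hy; rewrite !inE; lia.
    move=> ay; exists y./2; first by move: hy; rewrite !inE; lia.
    suff -> : y./2.*2 = y by [].
    by move: hy; rewrite !inE; lia.
  move=> j hj; have := allP noev j; rewrite mem_iota member_trace; last by lia.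
  by apply; lia.
- by rewrite drop_trace => e; right; split=> //; lia.
Qed.

(** Ampleness of a minimal counterexample comes from three sources: suffixes of
    at most 6 places are too short for excess 4, those of 8 and 10 places are
    excluded by [window_bound], and longer ones by minimality. *)
Lemma cnt_bound a n : 6 <= n -> ~ four_sums a -> cnt a n.*2 <= n + 3.
Proof.
elim/ltn_ind: n a => n IHn a hn noK.
case: (ltngtP n 6) hn => [|gt6 _|-> _]; [lia| |exact: cnt_six].
rewrite leqNgt; apply/negP=> big.
have am : ample a n.
  move=> j hj; case: (leqP (n - j) 3) => [le3|gt3].
    have := cnt_leD a j.*2 (n - j).*2; rewrite -doubleD subnKC; last by lia.
    by lia.
  case: (leqP (n - j) 5) => [le5|gt5].
    have hm : n - j \in [:: 4; 5] by rewrite !inE; lia.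
    have := window_bound (j := j) _ hm noK; rewrite subnKC; last by lia.
    by lia.
  have := IHn (n - j) _ (fun x => a (x + j.*2)) gt5 _.
  have := cnt_shift j.*2 a (n - j).*2; rewrite -doubleD subnK; last by lia.
  move=> e h; have {h} := h _ (fun K => noK (four_sums_shift K)); lia.
case: (leqP n 20) => [le20|gt20].
  have := head_classified (n := n) _ am noK; rewrite /head_ok size_trace.
  move=> /(_ _)/orP[|| /andP[]]; lia.
case: (head_or_tail (ltnW gt20) am noK) => [[_ noev c16] | [_]]; last by lia.
by have := @cnt_missing a n [::] _ noev isT isT; rewrite /=; lia.
Qed.

Lemma four_sums_has (A : {fset nat}) :
  four_sums (fun x => x \in A) -> has_four_sums A.
Proof.
move=> [b1 [b2 [b3 [b4 [h1 h2 h3 h4]]]]] /=.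
case/and5P=> A12 A13 A14 A23 /and3P[A24 A34 _].
exists (fun i : 'I_4 => nth 0 [:: b1; b2; b3; b4] i); split.
- move=> i j /eqP; rewrite nth_uniq ?ltn_ord //=; first by move/eqP/val_inj.
  by rewrite !inE; lia.
- by case=> [[|[|[|[|]]]]] //= _; lia.
- by case=> [[|[|[|[|]]]]] //= ? [[|[|[|[|]]]]].
Qed.

(** * The lower bound *)
Definition extremal (n x : nat) : bool :=
  odd x || (x \in [:: 2; n.*2 - 2; n.*2]).

Lemma cnt_extremal n : 3 <= n -> cnt (extremal n) n.*2 = n + 3.
Proof.
move=> hn; have [m em] : exists m, n = m.+3 by exists (n - 3); lia.
have low : cnt (extremal n) m.+1.*2 = m.+2.
  rewrite -cnt_odd2; apply/cnt_trace/trace_eqP => x hx.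
  by rewrite /extremal /odd2 !inE; congr (_ || _); lia.
have -> : n.*2 = m.+1.*2.+4 by lia.
rewrite 4!cntS low /extremal !inE /= odd_double /=; lia.
Qed.

(** Equal parities make the sum even, and 2 is not a sum of two distinct
    positive integers. *)
Lemma extremal_sum n b b' :
  0 < b -> 0 < b' -> b != b' -> b + b' <= n.*2 -> extremal n (b + b') ->
  if odd b == odd b' then n.*2 - 2 <= b + b' else b + b' < n.*2.
Proof.
move=> b0 b0' ne le; rewrite /extremal oddD !inE.
by case: (odd b) (odd b') (odd_double_half b) (odd_double_half b') => [] [] /=; lia.
Qed.

(** Three integers of one parity would have three distinct pair sums among 2n-2
    and 2n.  With two of each parity, the four integers add up to at least
    4n-4, while the sum of the larger members of the two pairs is odd, hence at
    most 2n-1, and the smaller members are at least 2 below: the total is at most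
    4n-6. *)
Lemma extremal_free n (w x y z : nat) :
  3 <= n -> 0 < w -> 0 < x -> 0 < y -> 0 < z -> uniq [:: w; x; y; z] ->
  ~~ all (fun s => (s <= n.*2) && extremal n s) (pair_sums w x y z).
Proof.
move=> hn w0 x0 y0 z0; rewrite /= !inE !negb_or !andbT.
case/and3P=> /and3P[wx wy wz] /andP[xy xz] yz; apply/negP.
case/and5P=> /andP[lwx ewx] /andP[lwy ewy] /andP[lwz ewz] /andP[lxy exy].
case/andP=> /andP[lxz exz] /andP[lyz eyz].
move: (extremal_sum w0 x0 wx lwx ewx) (extremal_sum w0 y0 wy lwy ewy)
      (extremal_sum w0 z0 wz lwz ewz) (extremal_sum x0 y0 xy lxy exy)
      (extremal_sum x0 z0 xz lxz exz) (extremal_sum y0 z0 yz lyz eyz).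
move: wx wy wz xy xz yz lwx lwy lwz lxy lxz lyz {w0 x0 y0 z0 ewx ewy ewz exy exz eyz}.
rewrite -(odd_double_half w) -(odd_double_half x) -(odd_double_half y)
        -(odd_double_half z) !oddD !odd_double !oddb !addbF.
move: (w./2) (x./2) (y./2) (z./2) => w' x' y' z'.
by case: (odd w); case: (odd x); case: (odd y); case: (odd z) => /=; lia.
Qed.

(** * The theorem *)

Theorem theorem3p2 (n : nat) (hn : 6 <= n) : is_h4 n 4%Z.
Proof.
split=> [A sA big | h' forces].
  have cA := cnt_card sA.
  have [//|noK] := classic (has_four_sums A).
  have := @cnt_bound (fun x => x \in A) n hn (fun K => noK (four_sums_has K)).
  by move: big; rewrite cA; lia.
pose A := [fset x in iota 1 n.*2 | extremal n x]%fset.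
have inA x : (x \in A) = (0 < x <= n.*2) && extremal n x.
  by rewrite !inE /= mem_iota; lia.
have cA : #|` A| = n + 3.
  rewrite (@cnt_card n) => [|x]; last by rewrite inA; lia.
  rewrite -cnt_extremal; last by lia.
  by apply/cnt_trace/trace_eqP => x hx; rewrite inA hx.
case: (boolP (4 <= h')%R) => // lt_h'; exfalso.
have [x | | b [inj pos sums]] := forces A; rewrite ?inA ?cA; try lia.
pose o k (lt_k : k < 4) : 'I_4 := Ordinal lt_k.
have ne k l (lt_k : k < 4) (lt_l : l < 4) : k != l -> b (o k lt_k) != b (o l lt_l).
  by apply: contra_neq => /inj [].
have hn3 : 3 <= n by lia.
have := @extremal_free n (b (o 0 isT)) (b (o 1 isT)) (b (o 2 isT)) (b (o 3 isT))
          hn3 (pos _) (pos _) (pos _) (pos _) _.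
rewrite [uniq _]/= !inE !negb_or !ne //= => /(_ isT) /negP; apply.
have sum k l (lt_k : k < 4) (lt_l : l < 4) : k < l ->
    (b (o k lt_k) + b (o l lt_l) <= n.*2) && extremal n (b (o k lt_k) + b (o l lt_l)).
  by move=> lt_kl; have := sums (o k lt_k) (o l lt_l) lt_kl; rewrite inA; lia.
by rewrite !sum.
Qed.
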